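(* Let $T>0$, let $u:[0,T]\to X$ be a mild solution of $u'(t)=\mathcal{A}_0u(t)+\mathcal{F}(t,u(t))$, $t\in[0,T]$, $u(0)=u_0\in X$, where: (i) $\mathcal{A}_0:D(\mathcal{A}_0)\subset X\to Y$ is the infinitesimal generator of a strongly continuous semigroup $\{\mathcal{T}_0(t)\}_{t\ge 0}$ on $X$, with $D(\mathcal{A}_0)\subset\{\psi\in Y\mid\mathcal{A}_0\psi\in Y\}$; (ii) $\mathcal{F}:[0,T]\times X\to Y$ is locally Lipschitz continuous with respect to its second argument in a strip along the exact solution $u$: for some $\overline{R}>0$ and all $R\in[0,\overline{R}]$ there exists $L>0$ such that $\|\mathcal{F}(t,w)-\mathcal{F}(t,v)\|_Y\le L\|w-v\|_Y$ for all $t\in[0,T]$ and all $w,v\in X$ with $\|w-u(t)\|_Y,\|v-u(t)\|_Y\le R$. Assume that $f(t):=\mathcal{F}(t,u(t))$, $t\in[0,T]$, is such that $f'\in L^{\infty}((0,T),Y)$. For a positive integer $N$ let $h=T/N$, $t_n=nh$, and let $u_1,\dots,u_N\in X$ be the exponential Euler approximations started from $u_0$, $$u_{n+1}=\mathcal{T}_0(h)u_n+h\,\varphi_1(h\mathcal{A}_0)\mathcal{F}(t_n,u_n),\qquad n=0,\dots,N-1,\qquad h\,\varphi_1(h\mathcal{A}_0)=\int_0^h\mathcal{T}_0(h-s)\,ds .$$ Then there is a constant $\tilde C$, which depends on $T$ but is independent of $h$ and $n$, such that $$\|u(t_n)-u_n\|_X\le \tilde C\,\max_{0\le t\le T}\|f'(t)\|_Y\cdot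 h,\qquad n=1,\dots,N .$$
   Context: Setting (sun-star framework in the sun-reflexive case). Let $X$ be a Banach space of functions with values in $\mathbb{R}^d$ and $\{T_0(t)\}_{t\ge 0}$ a $C_0$-semigroup on $X$. Let $X^{\odot}\subset X^*$ be the largest (closed) subspace on which the adjoint semigroup $\{T_0^*(t)\}_{t\ge0}$ is strongly continuous, let $T_0^{\odot}(t)$ be the restriction of $T_0^*(t)$ to $X^{\odot}$, let $X^{\odot *}$ be the dual of $X^{\odot}$, and let $T_0^{\odot *}(t)$ be the adjoint of $T_0^{\odot}(t)$, acting on $X^{\odot *}$. Let $X^{\odot\odot}\subset X^{\odot *}$ be the largest subspace on which $\{T_0^{\odot *}(t)\}_{t\ge 0}$ is strongly continuous. The embedding $j:X\to X^{\odot *}$ is $\langle j\phi,\psi^{\odot}\rangle=\langle\psi^{\odot},\phi\rangle$ for $\phi\in X$, $\psi^\odot\in X^\odot$. Sun-reflexivity is assumed: $j(X)=X^{\odot\odot}$. Through isometric isomorphisms, write $Z\cong X^{\odot}$ and $Y\cong X^{\odot *}$, Banach spaces of functions with values in $\mathbb{R}^d$, with duality pairing $\langle y,z\rangle$, $|\langle y,z\rangle|\le \|y\|_Y\|z\|_Z$, for $y\in Y$, $z\in Z$. Identify $X$ with the subspace $j(X)$ of $Y$, and write $\mathcal{T}_0(t)$ for $T_0^{\odot *}(t)$ acting on $Y$ (it extends $T_0(t)$ from $X$ to $Y$; it is strongly continuous on $X$ but not necessarily on $Y$). Standing assumption: there are constants $M,\omega$ with $\|\mathcal{T}_0(t)\|_{Y\leftarrow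 Y}\le M e^{\omega t}$ for all $t\ge 0$. Weak$^*$ integral: for $q:[0,t]\to Y$ such that $s\mapsto\langle q(s),z\rangle$ is integrable for every $z\in Z$, $Q=\int_0^t q(s)\,ds\in Y$ is the unique element with $\langle Q,z\rangle=\int_0^t\langle q(s),z\rangle\,ds$ for all $z\in Z$. All integrals involving $\mathcal{T}_0$ are understood in this sense; in particular $h\varphi_1(h\mathcal{A}_0)y=\int_0^h\mathcal{T}_0(h-s)y\,ds$ for $y\in Y$, which takes values in $X$. A mild solution is a function $u:[0,T]\to X$ satisfying $u(t)=\mathcal{T}_0(t)u_0+\int_0^t\mathcal{T}_0(t-s)\mathcal{F}(s,u(s))\,ds$ for $t\in[0,T]$. The condition $f'\in L^\infty((0,T),Y)$ means that $f(t)-f(s)=\int_s^t f'(\sigma)\,d\sigma$ for $0\le s\le t\le T$ with $f'$ essentially bounded in the norm of $Y$; $\max_{0\le t\le T}\|f'(t)\|_Y$ denotes its (essential) supremum. *)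

(* Defs.v *)
From HB Require Import structures.
From mathcomp Require Import all_boot all_order all_algebra.
From mathcomp Require Import all_classical all_reals all_analysis.
From mathcomp Require Import ess_sup_inf.

Set Implicit Arguments.
Unset Strict Implicit.
Unset Printing Implicit Defensive.

Import Order.TTheory GRing.Theory Num.Theory.
Import numFieldNormedType.Exports.

Local Open Scope classical_set_scope.
Local Open Scope ring_scope.

Definition bop_pred (R : realType) (V W : normedModType R) : {pred V -> W} :=
  [pred f | `[< linear f /\ continuous f >] ].
Arguments bop_pred {R} V W.

Record bop (R : realType) (V W : normedModType R) := Bop {
  bop_fun :> V -> W;
  bop_funP : bop_fun \in bop_pred V W }.

Section bop_lmodule.
Context (R : realType) (V W : normedModType R).

HB.instance Definition _ := [isSub for @bop_fun R V W].
HB.instance Definition _ := [Choice of bop V W by <:].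

Lemma bop_submod_closed : submod_closed (bop_pred V W).
Proof.
split.
  rewrite inE; split.
    by move=> a x y; rewrite scaler0 addr0.
  exact: cst_continuous.
move=> a f g; rewrite !inE => -[fl fc] [gl gc]; split.
  move=> b x y; rewrite !fctE fl gl !scalerDr !scalerA (mulrC a b).
  by rewrite addrACA.
move=> x; apply: continuousD; last exact: gc.
by apply: continuousZl_tmp; exact: fc.
Qed.

HB.instance Definition _ :=
  GRing.isSubmodClosed.Build R (V -> W) (bop_pred V W) bop_submod_closed.
HB.instance Definition _ := [SubChoice_isSubLmodule of bop V W by <:].

Lemma bop_linear (A : bop V W) : linear A.
Proof. by case: A => f /=; rewrite inE => -[]. Qed.

Lemma bop_continuous (A : bop V W) : continuous A.
Proof. by case: A => f /=; rewrite inE => -[]. Qed.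

HB.instance Definition _ (A : bop V W) :=
  GRing.isLinear.Build R V W *:%R A (bop_linear A).

End bop_lmodule.

Section bop_norm.
Context (R : realType) (V W : normedModType R).
Implicit Types A B : bop V W.

Definition opnorm A : R := sup [set `|A x| | x in [set x : V | `|x| <= 1] ].

Lemma bop_bounded A : exists M, forall x, `|A x| <= M * `|x|.
Proof.
have /linear_boundedP : bounded_near A (nbhs (0 : V)).
  by apply: continuous_linear_bounded; exact: bop_continuous.
by move=> /pinfty_ex_gt0[M _ AM]; exists M.
Qed.

Lemma opnorm_has_sup A : has_sup [set `|A x| | x in [set x : V | `|x| <= 1] ].
Proof.
split; first by exists `|A 0|; exists 0; rewrite //= normr0.
have [M AM] := bop_bounded A; exists `|M| => _ [x /= x1 <-].
apply: (le_trans (AM x)); apply: (@le_trans _ _ (`|M| * `|x|)).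
  by apply: ler_wpM2r => //; exact: ler_norm.
by rewrite ler_piMr.
Qed.

Lemma opnorm_ge0 A : 0 <= opnorm A.
Proof.
apply: (@le_trans _ _ `|A 0|) => //; apply: ub_le_sup; last first.
  by exists 0; rewrite //= normr0.
by case: (opnorm_has_sup A).
Qed.

Lemma le_opnorm A x : `|A x| <= opnorm A * `|x|.
Proof.
have [->|x0] := eqVneq x 0; first by rewrite linear0 !normr0 mulr0.
rewrite -ler_pdivrMr ?normr_gt0// mulrC -[X in X * _]ger0_norm; last first.
  by rewrite invr_ge0.
rewrite -normrZ -linearZ; apply: ub_le_sup.
  by case: (opnorm_has_sup A).
by exists (`|x|^-1 *: x) => //=; rewrite normrZ normfV normr_id mulVf ?normr_eq0.
Qed.

Lemma opnorm_le A M : 0 <= M -> (forall x, `|A x| <= M * `|x|) -> opnorm A <= M.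
Proof.
move=> M0 AM; apply: ge_sup; first by case: (opnorm_has_sup A).
by move=> _ [x /= x1 <-]; apply: (le_trans (AM x)); rewrite ler_piMr.
Qed.

Lemma bopD A B x : (A + B) x = A x + B x. Proof. by []. Qed.
Lemma bopZ (a : R) A x : (a *: A) x = a *: A x. Proof. by []. Qed.

Lemma opnormD A B : opnorm (A + B) <= opnorm A + opnorm B.
Proof.
apply: opnorm_le => [|x]; first by rewrite addr_ge0 ?opnorm_ge0.
rewrite bopD mulrDl; apply: (le_trans (ler_normD _ _)).
by apply: lerD; exact: le_opnorm.
Qed.

Lemma opnormZ_le (a : R) A : opnorm (a *: A) <= `|a| * opnorm A.
Proof.
apply: opnorm_le => [|x]; first by rewrite mulr_ge0 ?opnorm_ge0.
by rewrite bopZ normrZ -mulrA ler_wpM2l// le_opnorm.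
Qed.

Lemma opnormZ (a : R) A : opnorm (a *: A) = `|a| * opnorm A.
Proof.
apply/eqP; rewrite eq_le opnormZ_le/=.
have [->|a0] := eqVneq a 0; first by rewrite normr0 mul0r opnorm_ge0.
have := opnormZ_le a^-1 (a *: A); rewrite scalerA mulVf// scale1r normfV.
by rewrite mulrC ler_pdivlMr ?normr_gt0// mulrC.
Qed.

Lemma opnorm0_eq0 A : opnorm A = 0 -> A = 0.
Proof.
move=> A0; apply: val_inj; apply/funext => x /=; apply/eqP.
by rewrite -normr_le0 (le_trans (le_opnorm A x))// A0 mul0r.
Qed.

HB.instance Definition _ :=
  Lmodule_isNormed.Build R (bop V W) opnormD opnormZ opnorm0_eq0.

Lemma bop_normE A : `|A| = opnorm A. Proof. by []. Qed.

End bop_norm.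

Definition dual (R : realType) (V : normedModType R) := bop V R^o.

Lemma bop_comp_subproof (R : realType) (U V W : normedModType R)
  (A : bop V W) (B : bop U V) : A \o B \in bop_pred U W.
Proof.
rewrite inE; split.
  by move=> a x y; rewrite /= !linearP.
by move=> x; apply: continuous_comp; exact: bop_continuous.
Qed.

Definition bop_comp (R : realType) (U V W : normedModType R)
    (A : bop V W) (B : bop U V) : bop U W :=
  Bop (bop_comp_subproof A B).

Definition adjoint (R : realType) (V W : normedModType R) (A : bop V W) :
    dual W -> dual V :=
  fun psi => bop_comp psi A.

Definition C0_semigroup (R : realType) (V : normedModType R)
    (S : R -> bop V V) : Prop :=
  [/\ forall x, S 0 x = x,
      forall s t, 0 <= s -> 0 <= t -> forall x, S (s + t) x = S s (S t x)
    & forall x, S t x @[t --> 0^'+] --> x].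

(* The largest subspace on which the family S is strongly continuous. *)
Definition strong_continuity_space (R : realType) (V : normedModType R)
    (S : R -> V -> V) : set V :=
  [set x | {within `[0, +oo[, continuous (fun t => S t x)} ].

(* Z is the sun-dual of X and Y the dual of the sun-dual, up to the isometries
   sun_of and sunstar_of. The operators and the embedding below are uniquely
   determined by their defining equations: sun_T is the sun-dual semigroup read
   on Z,
   and sunstar_T its adjoint read on Y. Only times t >= 0 are meaningful. *)
Record sun_star_frame (R : realType) (X Z Y : completeNormedModType R) := {
  T0 : R -> bop X X;
  T0_C0_semigroup : C0_semigroup T0;
  sun_of : bop Z (dual X);
  sun_of_isometry : forall z, `|sun_of z| = `|z|;
  sun_of_range :
    range sun_of = strong_continuity_space (fun t => adjoint (T0 t));
  sun_T : R -> bop Z Z;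
  sun_TE : forall t, 0 <= t ->
    forall z, sun_of (sun_T t z) = adjoint (T0 t) (sun_of z);
  sunstar_of : bop Y (dual Z);
  sunstar_of_isometry : forall y, `|sunstar_of y| = `|y|;
  sunstar_of_range : range sunstar_of = setT;
  sunstar_T : R -> bop Y Y;
  sunstar_TE : forall t, 0 <= t ->
    forall y, sunstar_of (sunstar_T t y) = adjoint (sun_T t) (sunstar_of y);
  sun_embed : X -> Y;
  sun_embedE : forall phi z, sunstar_of (sun_embed phi) z = sun_of z phi;
  sun_reflexive :
    range sun_embed = strong_continuity_space (fun t => sunstar_T t) }.

Section weak_star.
Context (R : realType) (X Z Y : completeNormedModType R).
Variable E : sun_star_frame X Z Y.

Definition pairing (y : Y) (z : Z) : R := sunstar_of E y z.

Definition weak_star_integrable (a b : R) (q : R -> Y) : Prop :=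
  forall z, (@lebesgue_measure R).-integrable `[a, b]
    (EFin \o (fun s => pairing (q s) z)).

Definition is_weak_star_integral (a b : R) (q : R -> Y) (Q : Y) : Prop :=
  forall z, pairing Q z =
    \int[@lebesgue_measure R]_(s in `[a, b]) pairing (q s) z.

(* Such a Q is unique because sunstar_of is isometric; the default 0 is only
   taken when q is not weak_star_integrable on [a, b]. *)
Definition weak_star_integral (a b : R) (q : R -> Y) : Y :=
  xget 0 [set Q | is_weak_star_integral a b q Q].

(* y |-> h phi_1(h A_0) y *)
Definition h_phi1 (h : R) (y : Y) : Y :=
  weak_star_integral 0 h (fun s => sunstar_T E (h - s) y).

(* A : D(A) = D -> Y generates the semigroup on X; difference quotients of
   elements of X and their limits are read in Y. *)
Definition is_generator (D : set X) (A : X -> Y) : Prop :=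
  let quotient phi h :=
    h^-1 *: (sunstar_T E h (sun_embed E phi) - sun_embed E phi) in
  (forall phi, D phi <-> exists y : Y, quotient phi h @[h --> 0^'+] --> y) /\
  (forall phi, D phi -> quotient phi h @[h --> 0^'+] --> A phi).

Definition mild_solution (T : R) (F : R -> X -> Y) (u0 : X) (u : R -> X) :=
  forall t, 0 <= t <= T ->
    weak_star_integrable 0 t (fun s => sunstar_T E (t - s) (F s (u s))) /\
    sun_embed E (u t) = sunstar_T E t (sun_embed E u0) +
      weak_star_integral 0 t (fun s => sunstar_T E (t - s) (F s (u s))).

Definition lipschitz_in_strip (T : R) (F : R -> X -> Y) (u : R -> X) :=
  exists2 Rbar : R, 0 < Rbar & forall r, 0 <= r <= Rbar ->
    exists2 L : R, 0 < L & forall t, 0 <= t <= T -> forall w v : X,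
      `|sun_embed E w - sun_embed E (u t)| <= r ->
      `|sun_embed E v - sun_embed E (u t)| <= r ->
      `|F t w - F t v| <= L * `|sun_embed E w - sun_embed E v|.

(* The norm is extended by 0 outside ]0, T[; this does not change the
   essential supremum since norms are nonnegative and 0 < T. *)
Definition ess_sup_norm (T : R) (g : R -> Y) : \bar R :=
  ess_sup (@lebesgue_measure R) (EFin \o ((fun s => `|g s|) \_ `]0, T[)).

Definition Linfty_derivative (T : R) (f f' : R -> Y) : Prop :=
  (forall s t, 0 <= s -> s <= t -> t <= T ->
    weak_star_integrable s t f' /\ f t - f s = weak_star_integral s t f') /\
  (ess_sup_norm T f' < +oo)%E.

Definition exponential_euler (h : R) (N : nat) (F : R -> X -> Y) (u0 : X)
    (U : nat -> X) : Prop :=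
  U 0%N = u0 /\ forall n, (n < N)%N ->
    sun_embed E (U n.+1) = sunstar_T E h (sun_embed E (U n)) +
      h_phi1 h (F (n%:R * h) (U n)).

End weak_star.

(* Main.v *)
(** The error is estimated in weak form, by pairing with elements of Z. The
    variation-of-constants formula turns the error at t_n into
    [sum_(k < n) int_(t_k)^(t_(k+1)) <f(s) - F(t_k, U_k), S(t_n - s) z> ds],
    with S the sun-dual semigroup; since f is Lipschitz with constant K the
    essential supremum of f', a discrete Gronwall argument bounds the error in Y
    by C1 K h as long as C1 K h is below the radius of the strip. The finitely
    many coarser grids occur only when K > 0, and on each of them the
    approximations are unique because the embedding of X into Y is injective;
    they are absorbed in the constant.

    Returning from the norm of Y to that of X requires |x| <= c |j x|. A
    functional psi norming x (Hahn-Banach) need not belong to X^sun, but its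
    averages t^-1 int_0^t T_0^*(s) psi ds do, are bounded by a multiple of |psi|
    (Banach-Steinhaus), and take values at x converging to psi x. *)
From HB Require Import structures.
Require Import Defs.
From mathcomp Require Import all_boot all_order all_algebra.
From mathcomp Require Import all_classical all_reals all_analysis.
From mathcomp Require Import ess_sup_inf ring lra.
Import Order.TTheory GRing.Theory Num.Theory.
Import numFieldNormedType.Exports.
Local Open Scope classical_set_scope.
Local Open Scope ring_scope.

Set Implicit Arguments.
Unset Strict Implicit.

(** * The Hahn-Banach theorem *)

Section sublinear.
Context {R : realType} {V : lmodType R}.
Implicit Types (p q : V -> R) (x y : V).

(** Homogeneity is an inequality for positive factors only; applying it to the inverse factor gives
    equality. *)
Definition sublinear p :=
  (forall x y, p (x + y) <= p x + p y) /\
  (forall a x, 0 < a -> p (a *: x) <= a * p x).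

Lemma sublinearZ p a x : sublinear p -> 0 < a -> p (a *: x) = a * p x.
Proof.
move=> [_ pZ] a0; apply/eqP; rewrite eq_le pZ//=.
have /(pZ _ (a *: x)) : 0 < a^-1 by rewrite invr_gt0.
by rewrite scalerA mulVf ?gt_eqF// scale1r ler_pdivlMl.
Qed.

Lemma sublinear0 p : sublinear p -> p 0 = 0.
Proof.
move=> ps; have := @sublinearZ p 2 0 ps ltac:(by []).
by rewrite scaler0; lra.
Qed.

Lemma sublinearN p x : sublinear p -> - p (- x) <= p x.
Proof. by move=> ps; have := ps.1 x (- x); rewrite subrr sublinear0//; lra. Qed.

(** A sublinear minorant of [p] with value at most [- p y] at [- y] (take [t = 1]), so a linear
    functional below it must take the value [p y] at [y]. *)
Definition tilt p y x := inf [set p (x + t *: y) - t * p y | t in [set t | 0 <= t]].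

(** Subadditivity applied to [t *: y = - x + (x + t *: y)]. This makes the infimum defining [tilt]
    finite. *)
Lemma tilt_lbound p x y t : sublinear p -> 0 <= t ->
  - p (- x) <= p (x + t *: y) - t * p y.
Proof.
move=> ps; rewrite le_eqVlt => /predU1P[<-|t0].
  by rewrite scale0r addr0 mul0r subr0 sublinearN.
rewrite -sublinearZ// lerBrDr addrC lerBlDr.
by rewrite -{1}(addKr x (t *: y)) addrC ps.1.
Qed.

Lemma tilt_has_inf p x y : sublinear p ->
  has_inf [set p (x + t *: y) - t * p y | t in [set t | 0 <= t]].
Proof.
move=> ps; split; first by exists (p (x + 0 *: y) - 0 * p y), 0 => /=.
by exists (- p (- x)) => _ [t /= t0 <-]; exact: tilt_lbound.
Qed.

Lemma tilt_le p x y t : sublinear p -> 0 <= t ->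
  tilt p y x <= p (x + t *: y) - t * p y.
Proof.
by move=> ps t0; apply: ge_inf; [case: (tilt_has_inf x y ps)|exists t].
Qed.

Lemma tilt_ge p x y c : sublinear p ->
  (forall t, 0 <= t -> c <= p (x + t *: y) - t * p y) -> c <= tilt p y x.
Proof.
move=> ps cp; apply: lb_le_inf; first by case: (tilt_has_inf x y ps).
by move=> _ [t t0 <-]; exact: cp.
Qed.

Lemma tilt_le_self p x y : sublinear p -> tilt p y x <= p x.
Proof.
move=> ps; have := tilt_le x y ps (lexx 0).
by rewrite scale0r addr0 mul0r subr0.
Qed.

(** Competitors [s] and [t] for two summands give the competitor [s + t] for their sum; scaling by
    [a] turns the competitor [t] into [a * t]. *)
Lemma sublinear_tilt p y : sublinear p -> sublinear (tilt p y).
Proof.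
move=> ps; split=> [x1 x2|a x a0].
- rewrite -lerBlDr; apply: tilt_ge => // s s0.
  rewrite lerBlDr -lerBlDl; apply: tilt_ge => // t t0.
  rewrite lerBlDr; apply: le_trans (tilt_le _ _ ps (addr_ge0 s0 t0)) _.
  rewrite scalerDl addrACA mulrDl.
  by have := ps.1 (x1 + s *: y) (x2 + t *: y); lra.
- rewrite -ler_pdivrMl//; apply: tilt_ge => // t t0.
  rewrite ler_pdivrMl//.
  apply: le_trans (tilt_le _ _ ps (mulr_ge0 (ltW a0) t0)) _.
  by rewrite -scalerA -scalerDr sublinearZ// mulrBr mulrA.
Qed.

Definition sublinear_minimal p :=
  forall q, sublinear q -> (forall x, q x <= p x) -> q = p.

(** Zorn's lemma on the sublinear functionals below [p0], a nonempty chain being bounded by its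
    pointwise infimum. *)
Lemma exists_sublinear_minimal p0 : sublinear p0 ->
  exists p, [/\ sublinear p, forall x, p x <= p0 x & sublinear_minimal p].
Proof.
move=> p0s; pose P := {p | sublinear p /\ forall x, p x <= p0 x}.
(* The order is reversed, so that a maximal element for [le] is a minimal functional. *)
pose le (p q : P) := `[< forall x, sval q x <= sval p x >].
have P0 : P by exists p0.
have [||||[p [ps pp0]] pmin] := @Zorn P le.
- by move=> p; apply/asboolP.
- move=> r s t /asboolP rs /asboolP st; apply/asboolP => x.
  exact: le_trans (st x) (rs x).
- move=> s t /asboolP st /asboolP ts; apply: eq_sig_hprop => [q|].
    exact: Prop_irrelevance.
  by apply/funext => x; apply/le_anti; rewrite st ts.
- move=> A Atot; have [[a0 Aa0]|/forallNP A0] := pselect (exists a, A a); last first.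
    by exists P0 => s /A0.
  pose m x := inf [set sval p x | p in A].
  have Ainf x : has_inf [set sval p x | p in A].
    split; first by exists (sval a0 x), a0.
    (* Uniform over the chain, since [- p0 (- x) <= - p (- x) <= p x]. *)
    exists (- p0 (- x)) => _ [[q [qs qp0]] _ <-] /=.
    by apply: le_trans (sublinearN x qs); rewrite lerN2.
  have mle (p : P) x : A p -> m x <= sval p x.
    by move=> Ap; apply: ge_inf; [case: (Ainf x)|exists p].
  have mge x c : (forall p : P, A p -> c <= sval p x) -> c <= m x.
    move=> cp; apply: lb_le_inf; first by case: (Ainf x).
    by move=> _ [p Ap <-]; exact: cp.
  have ms : sublinear m.
    split=> [x y|a x a0'].
    + rewrite -lerBlDr; apply: (mge) => p Ap.
      rewrite lerBlDr -lerBlDl; apply: (mge) => q Aq; rewrite lerBlDr.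
      (* The smaller of the two members of the chain is the competitor at [x + y]. *)
      have [/asboolP pq|/asboolP qp] := Atot _ _ Ap Aq.
      * apply: le_trans (mle _ _ Aq) _.
        by have := (svalP q).1.1 x y; have := pq x; lra.
      * apply: le_trans (mle _ _ Ap) _.
        by have := (svalP p).1.1 x y; have := qp y; lra.
    + rewrite -ler_pdivrMl//; apply: (mge) => p Ap; rewrite ler_pdivrMl//.
      by apply: le_trans (mle _ _ Ap) _; exact: (svalP p).1.2.
  have mp0 x : m x <= p0 x.
    exact: le_trans (mle _ _ Aa0) ((svalP a0).2 x).
  exists (exist _ m (conj ms mp0)) => s As; apply/asboolP => x /=.
  exact: mle.
exists p; split=> // q qs qp.
have qp0 x : q x <= p0 x by exact: le_trans (qp x) (pp0 x).
have ple : le (exist _ p (conj ps pp0)) (exist _ q (conj qs qp0)).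
  exact/asboolP.
by have /(congr1 sval) := pmin _ ple.
Qed.

(** By minimality [p] equals each [tilt p y], and [t = 1] in the infimum gives
    [p x <= p (x + y) - p y], the missing half of additivity. *)
Lemma sublinear_minimal_linear p : sublinear p -> sublinear_minimal p ->
  linear (p : V -> R^o).
Proof.
move=> ps pmin.
have pD x y : p (x + y) = p x + p y.
  apply/le_anti; rewrite ps.1/=.
  have tp : tilt p y = p.
    by apply: pmin; [exact: sublinear_tilt|move=> ?; exact: tilt_le_self].
  have := tilt_le x y ps ler01.
  by rewrite tp scale1r mul1r; lra.
have pN x : p (- x) = - p x.
  by have := pD x (- x); rewrite subrr sublinear0//; lra.
move=> a x y; rewrite pD; congr (_ + _); rewrite -[RHS]/(a * p x).
have [a0|a0|<-] := ltgtP 0 a.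
- exact: sublinearZ.
- by rewrite -[a]opprK scaleNr pN sublinearZ ?oppr_gt0// !mulNr.
- by rewrite scale0r mul0r sublinear0.
Qed.

End sublinear.

Lemma bop_of_bound {R : realType} {V W : normedModType R} {f : V -> W} {c : R} :
  linear f -> (forall x, `|f x| <= c * `|x|) ->
  exists A : bop V W, forall x, A x = f x.
Proof.
move=> fl fc.
pose g : {linear V -> W} := HB.pack f (GRing.isLinear.Build _ _ _ _ _ fl).
have gc : continuous g.
  apply: bounded_linear_continuous; apply/linear_boundedP.
  near=> r => x; apply: le_trans (fc x) _.
  by rewrite ler_wpM2r//; near: r; exact: nbhs_pinfty_ge.
have fb : f \in bop_pred V W by rewrite inE; split.
by exists (Bop fb).
Unshelve. all: by end_near. Qed.

(** A minimal functional below the norm tilted in the direction [x] is linear and bounded by the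
    norm; its value at [- x] is at most minus the norm of [x], which fixes its value at [x]. *)
Theorem hahn_banach {R : realType} {V : normedModType R} (x : V) :
  exists psi : dual V, psi x = `|x| /\ forall y, `|psi y| <= `|y|.
Proof.
have ns : sublinear (fun y : V => `|y|).
  by split=> [y z|a y a0]; [exact: ler_normD|rewrite normrZ gtr0_norm].
have [p [ps ple pmin]] := exists_sublinear_minimal (sublinear_tilt x ns).
have pl := sublinear_minimal_linear ps pmin.
have pn y : p y <= `|y| by apply: le_trans (ple y) _; exact: tilt_le_self.
have pb y : `|(p y : R^o)| <= 1 * `|y|.
  rewrite mul1r ler_norml pn andbT.
  by have := sublinearN y ps; have := pn (- y); rewrite normrN; lra.
have [A Ap] := bop_of_bound pl pb.
exists A; split=> [|y]; last by rewrite Ap -[leRHS]mul1r.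
rewrite Ap; apply/le_anti; rewrite pn/=.
have := le_trans (ple (- x)) (tilt_le (- x) x ns ler01).
by rewrite scale1r addNr normr0 mul1r; have := sublinearN x ps; lra.
Qed.

(** * Integrals over intervals *)

Section interval_integrals.
Context {R : realType}.
Notation mu := (@lebesgue_measure R).
Implicit Types (f g : R -> R) (a b c : R).

Lemma within_continuous_integrable f a b :
  {within `[a, b], continuous f} -> mu.-integrable `[a, b] (EFin \o f).
Proof.
by move=> cf; apply: continuous_compact_integrable => //; exact: segment_compact.
Qed.

Lemma integrable_itvS f a b a' b' : a <= a' -> b' <= b ->
  mu.-integrable `[a, b] (EFin \o f) -> mu.-integrable `[a', b'] (EFin \o f).
Proof.
by move=> aa bb; apply: integrableS => //; apply: subset_itv; rewrite bnd_simp.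
Qed.

Lemma integrable_itvZ f a b c : mu.-integrable `[a, b] (EFin \o f) ->
  mu.-integrable `[a, b] (EFin \o (fun s => c * f s)).
Proof. by move=> fi; have := integrableZl _ c fi; apply. Qed.

Lemma Rintegral_itv_cat f a b c : a <= b -> b <= c ->
  mu.-integrable `[a, c] (EFin \o f) ->
  \int[mu]_(s in `[a, c]) f s =
  \int[mu]_(s in `[a, b]) f s + \int[mu]_(s in `[b, c]) f s.
Proof.
move=> ab bc fi; rewrite -(@Rintegral_itv_obnd_cbnd _ b).
  by rewrite -(Rintegral_itvB fi) ?bnd_simp//; ring.
by apply: integrableS fi => //; apply: subset_itv; rewrite bnd_simp.
Qed.

(** The bound is asked only inside the open interval, because [ess_sup_norm] carries no information
    at the endpoints. *)
Lemma ae_normr_Rintegral_le f a b c : a <= b -> 0 <= c ->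
  mu.-integrable `[a, b] (EFin \o f) ->
  {ae mu, forall s, s \in `]a, b[ -> `|f s| <= c} ->
  `|\int[mu]_(s in `[a, b]) f s| <= c * (b - a).
Proof.
move=> ab c0 fi fc.
have foi : mu.-integrable `]a, b[ (EFin \o f).
  by apply: integrableS fi => //; apply: subset_itv; rewrite bnd_simp.
rewrite -Rintegral_itv_bndo_bndc; last first.
  by apply: integrableS fi => //; apply: subset_itv; rewrite bnd_simp.
rewrite -Rintegral_itv_obnd_cbnd//.
apply: le_trans (le_normr_Rintegral _ foi) _ => //.
rewrite -lee_fin fineK; last first.
  by apply: integrable_fin_num => //; exact: integrable_norm.
have -> : (c * (b - a))%:E = (\int[mu]_(s in `]a, b[) c%:E)%E.
  rewrite integral_cst//= lebesgue_measure_itv/= lte_fin.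
  move: ab; rewrite le_eqVlt => /predU1P[->|->//].
  by rewrite ltxx subrr mulr0 mule0.
apply: ae_ge0_le_integral => //=.
- exact: measurable_int (integrable_norm foi).
Qed.

Lemma normr_Rintegral_le f a b c : a <= b ->
  mu.-integrable `[a, b] (EFin \o f) ->
  (forall s, a <= s <= b -> `|f s| <= c) ->
  `|\int[mu]_(s in `[a, b]) f s| <= c * (b - a).
Proof.
move=> ab fi fc; apply: ae_normr_Rintegral_le => //.
  by apply: le_trans (normr_ge0 (f a)) _; apply: fc; rewrite lexx.
by apply: aeW => s; rewrite in_itv/= => /andP[/ltW ? /ltW ?]; apply/fc/andP.
Qed.

Lemma Rintegral_shift f a b c : a <= b ->
  {within `[c + a, c + b], continuous f} ->
  \int[mu]_(s in `[c + a, c + b]) f s = \int[mu]_(s in `[a, b]) f (c + s).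
Proof.
move=> ab cf; rewrite /Rintegral.
have dE : derive1 (+%R c : R -> R) = cst 1.
  by apply/funext => x; rewrite derive1E deriveD// derive_cst derive_id add0r.
rewrite (@integration_by_substitution_increasing _ (+%R c))//.
- by congr fine; apply: eq_integral => s _; rewrite !fctE dE mulr1.
- by move=> x y _ _; rewrite ltrD2l.
- by rewrite dE => x _; exact: cvg_cst.
- by rewrite dE; exact: is_cvg_cst.
- by rewrite dE; exact: is_cvg_cst.
- split=> //.
  + apply: cvg_at_right_filter; apply: cvgD; [exact: cvg_cst|exact: cvg_id].
  + apply: cvg_at_left_filter; apply: cvgD; [exact: cvg_cst|exact: cvg_id].
Qed.

End interval_integrals.

(** * Continuity relative to a subset of the line *)

Lemma within_continuous_distP (R : realType) (V : normedModType R)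
    (A : set R) (g : R -> V) :
  {within A, continuous g} <->
  forall x, A x -> forall e, 0 < e -> exists2 d, 0 < d &
    forall y, A y -> `|x - y| < d -> `|g x - g y| < e.
Proof.
split=> [/subspace_continuousP gc x Ax e e0|gc].
  have /cvgrPdist_lt/(_ e e0) := gc x Ax.
  move=> /nbhs_ballP[d /= d0 dg]; exists d => // y Ay xy.
  exact: dg.
apply/subspace_continuousP => x Ax; apply/cvgrPdist_lt => e e0.
have [d d0 dg] := gc x Ax e e0.
by apply/nbhs_ballP; exists d => //= y xy Ay; exact: dg.
Qed.

Lemma within_continuous_lipschitz (R : realType) (V : normedModType R) (g : R -> V) :
  (forall a, 0 <= a -> exists c, forall r s, 0 <= r -> r <= s -> s <= a ->
     `|g r - g s| <= c * (s - r)) ->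
  {within `[0, +oo[, continuous g}.
Proof.
move=> gl; apply/within_continuous_distP => x; rewrite /= in_itv/= andbT => x0 e e0.
have [c gc] := gl (x + 1) ltac:(by rewrite addr_ge0).
have c1 : 0 < `|c| + 1 by rewrite ltr_pwDr.
(* The cap 1 keeps [y] in [[0, x + 1]], where [c] is valid; adding 1 to the denominator covers
   [c = 0]. *)
exists (Num.min 1 (e / (`|c| + 1))).
  by rewrite lt_min ltr01 divr_gt0.
move=> y; rewrite /= in_itv/= andbT lt_min => y0 /andP[xy1].
rewrite ltr_pdivlMr// => /(le_lt_trans _); apply.
have cc : c <= `|c| + 1 by rewrite (le_trans (ler_norm c))// lerDl.
have [xy|yx] := leP x y.
  apply: le_trans (gc _ _ _ _ _) _ => //.
    by move: xy1; rewrite distrC ger0_norm ?subr_ge0//; lra.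
  rewrite distrC ger0_norm ?subr_ge0// mulrC.
  by rewrite ler_wpM2l// subr_ge0.
rewrite distrC; apply: le_trans (gc _ _ _ _ _) _ => //; [exact: ltW|lra|].
rewrite ger0_norm ?subr_ge0 ?(ltW yx)// mulrC.
by rewrite ler_wpM2l// subr_ge0 ltW.
Qed.

(** * Strongly continuous semigroups *)

Section bop_lemmas.
Context {R : realType} {V W : normedModType R}.
Implicit Types A : bop V W.

Lemma bop_norm_apply A x : `|A x| <= `|A| * `|x|.
Proof. exact: le_opnorm. Qed.

Lemma bop_norm_le A c : 0 <= c -> (forall x, `|A x| <= c * `|x|) -> `|A| <= c.
Proof. exact: opnorm_le. Qed.

Lemma bop_norm_le_ball A c : (forall x, `|x| <= 1 -> `|A x| <= c) -> `|A| <= c.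
Proof.
move=> Ac; apply: ge_sup; first by case: (opnorm_has_sup A).
by move=> _ [x /= x1 <-]; exact: Ac.
Qed.

Lemma within_continuous_bop A (D : set R) (g : R -> V) :
  {within D, continuous g} -> {within D, continuous (fun t => A (g t))}.
Proof.
by move=> gc t; apply: continuous_comp; [exact: gc|exact: bop_continuous].
Qed.

End bop_lemmas.

Lemma opbound_ge0 (R : realType) (V : normedModType R) (S : R -> bop V V) (a c : R) :
  0 <= a -> (forall t, 0 <= t <= a -> `|S t| <= c) -> 0 <= c.
Proof.
by move=> a0 cP; apply: le_trans (normr_ge0 (S 0)) _; apply: cP; rewrite lexx.
Qed.

Section C0_semigroup.
Context {R : realType} {V : completeNormedModType R} {S : R -> bop V V}.
Hypothesis SC0 : C0_semigroup S.
Notation mu := (@lebesgue_measure R).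

(** Otherwise there are times [t n] tending to 0 with unbounded operator norms, although each orbit
    is bounded along them; this contradicts Banach-Steinhaus. *)
Lemma C0_semigroup_bounded_near0 :
  exists2 d, 0 < d & exists c, forall t, 0 <= t <= d -> `|S t| <= c.
Proof.
have [S0 _ Sc] := SC0.
apply: contrapT => nb.
have /choice[t tP] (n : nat) : exists t, 0 <= t <= n.+1%:R^-1 /\ n%:R < `|S t|.
  apply: contrapT => /forallNP nt; apply: nb; exists n.+1%:R^-1; first by [].
  by exists n%:R => t tn; rewrite leNgt; apply/negP => tn'; exact: (nt t).
pose F := [set (S (t n) : V -> V) | n in setT].
have FP f : F f -> bounded_fun_norm f /\ linear f.
  move=> [n _ <-]; split; last exact: bop_linear.
  move=> r; exists (`|S (t n)| * r) => x xr.
  by apply: le_trans (bop_norm_apply _ _) _; rewrite ler_wpM2l.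
have Fb : pointwise_bounded F.
  move=> x; have /cvgrPdist_lt/(_ 1 ltr01) := Sc x.
  move=> [d /= d0 dP].
  have [N Nd] : exists N : nat, forall n, (N <= n)%N -> n.+1%:R^-1 < d.
    exists (Num.truncn d^-1) => n; rewrite -(ler_nat R) => dn.
    rewrite -[ltRHS]invrK ltf_pV2 ?posrE ?invr_gt0//.
    by apply: lt_le_trans (truncnS_gt _) _; rewrite ler_nat ltnS -(ler_nat R).
  (* From index [N] on, [S (t n) x] is within 1 of [x]; the finitely many earlier values are covered
     by their sum. *)
  exists (`|x| + 1 + \sum_(i < N) `|S (t i) x|) => _ [n _ <-].
  have sum0 : 0 <= \sum_(i < N) `|S (t i) x| by exact: sumr_ge0.
  have [nN|Nn] := ltnP n N.
    rewrite (bigD1 (Ordinal nN))//= addrA addrAC lerDr.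
    by rewrite addr_ge0 ?addr_ge0 ?sumr_ge0.
  rewrite -[leLHS]addr0 lerD//.
  have [/andP[tn0 tn] _] := tP n.
  (* The limit at 0 is one-sided and excludes 0, so [t n = 0] is treated apart. *)
  move: tn0; rewrite le_eqVlt => /predU1P[<-|tn0]; first by rewrite S0 lerDl.
  have /= := dP (t n) _ tn0; rewrite sub0r normrN gtr0_norm//.
  move=> /(_ (le_lt_trans tn (Nd _ Nn))) xS.
  rewrite -[S _ x](subrK x) addrC; apply: le_trans (ler_normD _ _) _.
  by rewrite lerD2l distrC ltW.
have [c cP] := Banach_Steinhauss FP Fb 1.
have := (tP (Num.truncn c).+1).2; apply/negP; rewrite -leNgt.
apply: le_trans (_ : c <= _); last by rewrite ltW// truncnS_gt.
by apply: bop_norm_le_ball => x x1; apply: cP => //; exists (Num.truncn c).+1.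
Qed.

(** The semigroup law propagates the bound on [[0, d]] in steps of length [d]. *)
Lemma C0_semigroup_bounded a : exists c, forall t, 0 <= t <= a -> `|S t| <= c.
Proof.
have [S0 SD _] := SC0.
have [d d0 [c cP]] := C0_semigroup_bounded_near0.
have c0 : 0 <= c by apply: (opbound_ge0 (ltW d0) cP).
have [n an] : exists n : nat, a <= n%:R * d.
  exists (Num.truncn (a / d)).+1; rewrite -ler_pdivrMr//.
  by rewrite ltW// truncnS_gt.
suff [c' c'P] : exists c', forall t, 0 <= t <= n%:R * d -> `|S t| <= c'.
  by exists c' => t /andP[t0 ta]; apply: c'P; rewrite t0 (le_trans ta).
elim: n {an} => [|n [b bP]].
  exists c => t /andP[t0 t1]; apply: cP; rewrite t0/=.
  by apply: le_trans t1 _; rewrite mul0r ltW.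
have b0 : 0 <= b.
  by apply: (opbound_ge0 _ bP); rewrite mulr_ge0// ltW.
exists (c + c * b) => t /andP[t0 tn].
have [td|dt] := leP t d.
  by apply: le_trans (cP _ _) _; rewrite ?t0// lerDl mulr_ge0.
apply: bop_norm_le => [|x]; first by rewrite addr_ge0 ?mulr_ge0.
have dt0 : 0 <= t - d by rewrite subr_ge0 ltW.
have -> : S t x = S d (S (t - d) x) by rewrite -SD ?(ltW d0)// subrKC.
apply: le_trans (bop_norm_apply _ _) _.
apply: (@le_trans _ _ (c * (b * `|x|))).
  apply: ler_pM => //; first by apply: cP; rewrite lexx ltW.
  apply: le_trans (bop_norm_apply _ _) _; apply: ler_wpM2r => //.
  by apply: bP; rewrite dt0/=; move: tn; rewrite -natr1 mulrDl mul1r lerBlDr.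
by rewrite mulrA ler_wpM2r// lerDr.
Qed.

(** Factoring out [S r] reduces both one-sided continuity statements at a positive time to right
    continuity at 0. *)
Lemma C0_semigroup_orbit_dist a c x r s :
  (forall t, 0 <= t <= a -> `|S t| <= c) -> 0 <= r -> r <= s -> s <= a ->
  `|S s x - S r x| <= c * `|S (s - r) x - x|.
Proof.
move=> cP r0 rs sa; have [_ SD _] := SC0.
have -> : S s x = S r (S (s - r) x) by rewrite -SD ?subr_ge0// subrKC.
rewrite -linearB.
apply: le_trans (bop_norm_apply _ _) _; apply: ler_wpM2r => //.
by apply: cP; rewrite r0 (le_trans rs).
Qed.

Lemma C0_semigroup_orbit_continuous x :
  {within `[0, +oo[, continuous (fun t => S t x)}.
Proof.
apply/within_continuous_distP => s; rewrite /= in_itv/= andbT => s0 e e0.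
have [c cP] := C0_semigroup_bounded (s + 1).
have c0 : 0 <= c by apply: (opbound_ge0 _ cP); rewrite addr_ge0.
have [S0 _ Sc] := SC0.
have ec : 0 < e / (c + 1) by rewrite divr_gt0// ltr_wpDl.
have /cvgrPdist_lt/(_ _ ec)[d /= d0 dP] := Sc x.
have small t : 0 <= t -> t < d -> c * `|S t x - x| < e.
  rewrite le_eqVlt => /predU1P[<- _|t0 td].
    by rewrite S0 subrr normr0 mulr0.
  have := dP t; rewrite /= sub0r normrN gtr0_norm// distrC => /(_ td t0).
  rewrite ltr_pdivlMr ?ltr_wpDl// mulrC; apply: le_lt_trans.
  by rewrite ler_wpM2r// lerDl.
exists (Num.min 1 d); first by rewrite lt_min ltr01.
move=> r; rewrite /= in_itv/= andbT lt_min => r0 /andP[sr1 srd].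
have [rs|sr] := leP r s.
  apply: le_lt_trans (C0_semigroup_orbit_dist x cP r0 rs _) _; first by rewrite lerDl.
  apply: small; first by rewrite subr_ge0.
  by move: srd; rewrite ger0_norm ?subr_ge0.
have sr' := ltW sr.
move: sr1 srd; rewrite distrC ger0_norm ?subr_ge0// => sr1 srd.
rewrite distrC.
apply: le_lt_trans (C0_semigroup_orbit_dist x cP s0 sr' _) _.
  by rewrite -lerBlDl ltW.
by apply: small; rewrite ?subr_ge0.
Qed.

(** * Averages of adjoint orbits *)

Section average.
Context (psi : dual V).

Lemma within_continuous_functional_orbit x :
  {within `[0, +oo[, continuous (fun t => psi (S t x) : R)}.
Proof.
exact: (within_continuous_bop (A := psi) (@C0_semigroup_orbit_continuous x)).
Qed.

Lemma integrable_functional_orbit x a b : 0 <= a ->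
  mu.-integrable `[a, b] (EFin \o (fun t => psi (S t x) : R)).
Proof.
move=> a0; apply: within_continuous_integrable.
apply: continuous_subspaceW (@within_continuous_functional_orbit x).
by move=> t; rewrite /= !in_itv/= andbT => /andP[/(le_trans a0)].
Qed.

Lemma functional_orbit_le x a c t :
  (forall t, 0 <= t <= a -> `|S t| <= c) -> 0 <= t <= a ->
  `|psi (S t x)| <= `|psi| * (c * `|x|).
Proof.
move=> cP ta; apply: le_trans (bop_norm_apply _ _) _; apply: ler_wpM2l => //.
by apply: le_trans (bop_norm_apply _ _) _; rewrite ler_wpM2r// cP.
Qed.

(** The average is formed pointwise in [x], as the adjoint orbit of [psi] need not be
    norm-continuous. *)
Lemma exists_average t c : 0 < t ->
    (forall s, 0 <= s <= t -> `|S s| <= c) ->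
  exists phi : dual V, `|phi| <= `|psi| * c /\
    forall x, phi x = t^-1 * \int[mu]_(s in `[0, t]) (psi (S s x) : R).
Proof.
move=> t0 cP.
pose f x : R^o := t^-1 * \int[mu]_(s in `[0, t]) (psi (S s x) : R).
have c0 : 0 <= c by exact: opbound_ge0 (ltW t0) cP.
have fl : linear f.
  move=> a x y; rewrite /f -[RHS]/(a * _ + _) mulrCA -mulrDr; congr (_ * _).
  rewrite -RintegralZl//; last exact: integrable_functional_orbit.
  rewrite -RintegralD//; last exact: integrable_functional_orbit.
    by apply: eq_Rintegral => s _; rewrite !linearP.
  exact/integrable_itvZ/integrable_functional_orbit.
have fb x : `|f x| <= (`|psi| * c) * `|x|.
  rewrite /f normrM gtr0_norm ?invr_gt0// ler_pdivrMl// mulrC -mulrA.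
  rewrite -[in leRHS](subr0 t).
  apply: normr_Rintegral_le (ltW t0) (integrable_functional_orbit _ _ (lexx _)) _.
  by move=> s; exact: functional_orbit_le.
have [phi phiE] := bop_of_bound fl fb.
exists phi; split=> //; apply: bop_norm_le => [|x]; first by rewrite mulr_ge0.
by rewrite phiE.
Qed.

(** Composing with [S r] moves the window of integration from [[0, t]] to [[r, r + t]]. Windows
    starting at [r] and [s] differ by two intervals of length [s - r], so the adjoint orbit is
    Lipschitz on bounded intervals. *)
Lemma average_in_sun (phi : dual V) t : 0 < t ->
  (forall x, phi x = t^-1 * \int[mu]_(s in `[0, t]) (psi (S s x) : R)) ->
  strong_continuity_space (fun r => adjoint (S r)) phi.
Proof.
move=> t0 phiE; have [_ SD _] := SC0.
have phiS x r : 0 <= r ->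
    phi (S r x) = t^-1 * \int[mu]_(s in `[r, r + t]) (psi (S s x) : R).
  move=> r0; rewrite phiE; congr (_ * _).
  have -> : `[r, r + t] = `[r + 0, r + t] by rewrite addr0.
  rewrite (@Rintegral_shift _ (fun s => psi (S s x) : R)) ?(ltW t0)//; last first.
    apply: continuous_subspaceW (@within_continuous_functional_orbit x).
    by move=> s; rewrite /= !in_itv/= addr0 andbT => /andP[/(le_trans r0)].
  apply: eq_Rintegral => s; rewrite inE/= in_itv/= => /andP[s0 _].
  by rewrite addrC SD.
apply: within_continuous_lipschitz => a a0.
(* The shifted windows reach up to [s + t], hence the range [a + t]. *)
have [c cP] := C0_semigroup_bounded (a + t).
have c0 : 0 <= c by apply: (opbound_ge0 _ cP); rewrite addr_ge0// ltW.
exists (t^-1 * (2 * (`|psi| * c))) => r s r0 rs sa.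
have sr0 : 0 <= s - r by rewrite subr_ge0.
apply: bop_norm_le => [|x].
  by rewrite !mulr_ge0 ?invr_ge0 ?(ltW t0).
rewrite -[X in `|X|]/(phi (S r x) - phi (S s x)) !phiS// ?(le_trans r0)//.
rewrite -mulrBr normrM gtr0_norm ?invr_gt0// -!mulrA ler_wpM2l ?invr_ge0 ?(ltW t0)//.
have int a' b' := @integrable_functional_orbit x a' b'.
have st : s <= s + t by rewrite lerDl ltW.
have rt : r <= r + t by rewrite lerDl ltW.
have rst : r + t <= s + t by rewrite lerD2r.
(* Splitting [[r, s + t]] both at [s] and at [r + t] avoids distinguishing whether the windows
   overlap. *)
have := Rintegral_itv_cat rs st (int r (s + t) r0).
rewrite (Rintegral_itv_cat rt rst (int r (s + t) r0)).
move=> cat.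
have bound a' b' : 0 <= a' -> a' <= b' -> b' <= a + t ->
    `|\int[mu]_(s in `[a', b']) (psi (S s x) : R)| <=
    `|psi| * (c * `|x|) * (b' - a').
  move=> a'0 ab' bat; apply: normr_Rintegral_le (int _ _ a'0) _ => // u /andP[au ub].
  apply: functional_orbit_le cP _.
  by rewrite (le_trans a'0 au) (le_trans ub bat).
have := bound r s r0 rs ltac:(by rewrite (le_trans sa)// lerDl ltW).
have := bound (r + t) (s + t) (le_trans r0 rt) rst ltac:(by rewrite lerD2r).
move=> le1 le2.
apply: le_trans (_ : `|\int[mu]_(u in `[r, s]) (psi (S u x) : R) -
  \int[mu]_(u in `[r + t, s + t]) (psi (S u x) : R)| <= _).
  by rewrite le_eqVlt; apply/orP; left; apply/eqP; congr (`|_|); lra.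
apply: le_trans (ler_normB _ _) _; apply: le_trans (lerD le2 le1) _.
by rewrite le_eqVlt; apply/orP; left; apply/eqP; ring.
Qed.

End average.
End C0_semigroup.

(** * Sun-star frames *)

Section sun_star_frame_lemmas.
Context {R : realType} {X Z Y : completeNormedModType R}.
Variable E : sun_star_frame X Z Y.
Notation mu := (@lebesgue_measure R).
Implicit Types (x : X) (y : Y) (z : Z) (a b c t : R).

Lemma pairing_linearr y : linear (pairing E y : Z -> R^o).
Proof. exact: bop_linear. Qed.

Lemma pairingB y y' z : pairing E (y - y') z = pairing E y z - pairing E y' z.
Proof. by rewrite /pairing linearB. Qed.

Lemma pairingD y y' z : pairing E (y + y') z = pairing E y z + pairing E y' z.
Proof. by rewrite /pairing linearD. Qed.

Lemma normr_pairing_le y z : `|pairing E y z| <= `|y| * `|z|.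
Proof.
by rewrite -(sunstar_of_isometry E y); exact: (bop_norm_apply (sunstar_of E y)).
Qed.

Lemma pairing_norm_le y c : 0 <= c ->
  (forall z, `|pairing E y z| <= c * `|z|) -> `|y| <= c.
Proof.
by move=> c0 yc; rewrite -(sunstar_of_isometry E y); exact: bop_norm_le.
Qed.

Lemma pairing_inj y y' : (forall z, pairing E y z = pairing E y' z) -> y = y'.
Proof.
move=> yy'; apply/subr0_eq/normr0_eq0/le_anti; rewrite normr_ge0 andbT.
by apply: pairing_norm_le => // z; rewrite pairingB yy' subrr normr0 mul0r.
Qed.

(** Moves the semigroup from [Y], where orbits may be discontinuous, to [Z], where they are
    norm-continuous. *)
Lemma pairing_sunstar_T t y z : 0 <= t ->
  pairing E (sunstar_T E t y) z = pairing E y (sun_T E t z).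
Proof. by move=> t0; rewrite /pairing sunstar_TE. Qed.

Lemma sun_of_inj : injective (sun_of E).
Proof.
move=> z z' zz'; apply/subr0_eq/normr0_eq0.
by rewrite -(sun_of_isometry E) linearB/= zz' subrr normr0.
Qed.

Lemma sun_T0 z : sun_T E 0 z = z.
Proof.
apply: sun_of_inj; rewrite sun_TE//; apply/val_inj/funext => x /=.
by have [-> _ _] := T0_C0_semigroup E.
Qed.

Lemma sun_TD s t z : 0 <= s -> 0 <= t ->
  sun_T E (s + t) z = sun_T E s (sun_T E t z).
Proof.
move=> s0 t0; apply: sun_of_inj; rewrite !sun_TE ?addr_ge0//.
apply/val_inj/funext => x /=.
(* Adjoints compose in reverse order, which commutativity of time addition repairs. *)
by have [_ SD _] := T0_C0_semigroup E; rewrite addrC SD.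
Qed.

Lemma sun_T_continuous z : {within `[0, +oo[, continuous (fun t => sun_T E t z)}.
Proof.
have /within_continuous_distP zc :
    strong_continuity_space (fun t => adjoint (T0 E t)) (sun_of E z).
  by rewrite -(sun_of_range E); exists z.
apply/within_continuous_distP => t tE e e0.
have [d d0 dP] := zc t tE e e0; exists d => // s sE ts.
move: tE sE (dP s sE ts); rewrite /= !in_itv/= !andbT => t0 s0.
by rewrite -!sun_TE// -linearB sun_of_isometry.
Qed.

Lemma sun_embedB x x' : sun_embed E (x - x') = sun_embed E x - sun_embed E x'.
Proof.
apply: pairing_inj => z.
by rewrite pairingB /pairing !sun_embedE linearB.
Qed.

Lemma norm_le_sun_embed :
  exists2 K, 0 <= K & forall x, `|x| <= K * `|sun_embed E x|.
Proof.
have SC0 := T0_C0_semigroup E.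
have [c cP] := C0_semigroup_bounded SC0 1.
have c0 : 0 <= c := opbound_ge0 ler01 cP.
exists c => // x; apply/ler_addgt0Pr => e e0.
have [psi [psix psi1]] := hahn_banach x.
have psin : `|psi| <= 1 by apply: bop_norm_le => // w; rewrite mul1r.
have /within_continuous_distP psic :=
  @within_continuous_functional_orbit R X (T0 E) SC0 psi x.
have [] := psic 0 _ e e0; first by rewrite /= in_itv/= lexx.
have [S0 _ _] := SC0; rewrite S0 psix => d d0 dP.
(* [t <= 1] makes [c] a bound for the semigroup on [[0, t]], and [t < d] keeps [psi] along the orbit
   within [e] of the norm of [x]; its average then exceeds that norm minus [e]. *)
pose t := Num.min 1 (d / 2).
have t0 : 0 < t by rewrite lt_min ltr01 divr_gt0.
have cPt s : 0 <= s <= t -> `|T0 E s| <= c.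
  move=> /andP[s0 st]; apply: cP; rewrite s0 (le_trans st)//.
  by rewrite ge_min lexx.
have [phi [phin phiE]] := exists_average SC0 psi t0 cPt.
have := average_in_sun SC0 t0 phiE.
rewrite -[X in X phi -> _]/(strong_continuity_space (fun r => adjoint (T0 E r))).
rewrite -(sun_of_range E) => -[z _ zphi].
have phix : phi x <= c * `|sun_embed E x|.
  apply: le_trans (ler_norm _) _.
  rewrite -zphi -(sun_embedE E x z) mulrC.
  apply: le_trans (normr_pairing_le _ _) _; rewrite ler_wpM2l//.
  rewrite -(sun_of_isometry E) zphi (le_trans phin)// -[leRHS]mul1r.
  by rewrite ler_wpM2r.
rewrite -lerBlDr; apply: le_trans phix.
rewrite phiE ler_pdivlMl//.
have -> : t * (`|x| - e) = \int[mu]_(s in `[0, t]) (`|x| - e).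
  rewrite Rintegral_cst//= lebesgue_measure_itv/= lte_fin t0/= subr0.
  by rewrite mulrC.
apply: le_Rintegral => //.
- by apply: within_continuous_integrable; apply: continuous_subspaceT; exact: cst_continuous.
- exact: integrable_functional_orbit.
move=> s; rewrite /= in_itv/= => /andP[s0 st].
rewrite lerBlDr -lerBlDl; apply/ltW/(le_lt_trans (ler_norm _)).
apply: dP; first by rewrite /= in_itv/= s0.
rewrite sub0r normrN ger0_norm//.
apply: le_lt_trans st _; rewrite gt_min; apply/orP; right.
by rewrite gtr_pMr// invf_lt1// ltr1n.
Qed.

Lemma sun_embed_inj : injective (sun_embed E).
Proof.
move=> x x' xx'; apply/subr0_eq/normr0_eq0/le_anti; rewrite normr_ge0 andbT.
have [K _ KP] := norm_le_sun_embed.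
by rewrite (le_trans (KP _))// sun_embedB xx' subrr normr0 mulr0.
Qed.

(** The bound with constant [c] makes the integral a bounded functional of [z], which surjectivity
    of [sunstar_of] represents by an element of [Y]; thus [xget] does not fall back on its
    default. *)
Lemma weak_star_integralP a b (q : R -> Y) c :
  weak_star_integrable E a b q ->
  (forall z, `|\int[mu]_(s in `[a, b]) pairing E (q s) z| <= c * `|z|) ->
  forall z, pairing E (weak_star_integral E a b q) z =
            \int[mu]_(s in `[a, b]) pairing E (q s) z.
Proof.
move=> qi qc.
pose f z : R^o := \int[mu]_(s in `[a, b]) pairing E (q s) z.
have int z : mu.-integrable `[a, b] (EFin \o (fun s => pairing E (q s) z)) := qi z.
have fl : linear f.
  move=> k z w; rewrite /f -[RHS]/(k * _ + _).
  rewrite -RintegralZl// -RintegralD//; last exact: integrable_itvZ (int z).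
  by apply: eq_Rintegral => s _; rewrite (pairing_linearr (q s) k z w).
have [A AE] := bop_of_bound fl qc.
have [Q _ QA] : range (sunstar_of E) A by rewrite sunstar_of_range.
have : is_weak_star_integral E a b q Q by move=> z; rewrite /pairing QA AE.
by rewrite /weak_star_integral; exact: xgetI.
Qed.

Section bounds.
Context {M omega T : R}.
Hypothesis growth : forall t, 0 <= t -> `|sunstar_T E t| <= M * expR (omega * t).

Lemma sunstar_T_bounded :
  exists2 B, 0 <= B & forall t, 0 <= t <= T -> `|sunstar_T E t| <= B.
Proof.
have M0 : 0 <= M.
  have := growth (lexx 0); rewrite mulr0 expR0 mulr1.
  exact: le_trans (normr_ge0 _).
(* The sign of [omega] is unknown; its absolute value makes the exponent monotone in [t]. *)
exists (M * expR (`|omega| * T)); first by rewrite mulr_ge0// expR_ge0.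
move=> t /andP[t0 tT]; apply: le_trans (growth t0) _; rewrite ler_wpM2l//.
rewrite ler_expR; apply: le_trans (_ : `|omega| * t <= _).
  by rewrite ler_wpM2r// ler_norm.
by rewrite ler_wpM2l.
Qed.

End bounds.

Lemma pairing_sun_T_le B T t y z :
  (forall t, 0 <= t <= T -> `|sunstar_T E t| <= B) -> 0 <= t <= T ->
  `|pairing E y (sun_T E t z)| <= B * `|y| * `|z|.
Proof.
move=> BP /[dup] tT /andP[t0 _]; rewrite -pairing_sunstar_T//.
apply: le_trans (normr_pairing_le _ _) _; rewrite ler_wpM2r//.
by apply: le_trans (bop_norm_apply _ _) _; rewrite ler_wpM2r// BP.
Qed.

Lemma within_continuous_pairing_sun_T t a y z :
  {within `[a, t], continuous (fun s => pairing E y (sun_T E (t - s) z))}.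
Proof.
apply: (within_continuous_bop (A := sunstar_of E y)).
apply/within_continuous_distP => s; rewrite /= in_itv/= => /andP[_ st] e e0.
have /within_continuous_distP zc := @sun_T_continuous z.
have ts : `[0, +oo[%classic (t - s) by rewrite /= in_itv/= andbT subr_ge0.
have [d d0 dP] := zc _ ts e e0; exists d => // r; rewrite /= in_itv/= => /andP[_ rt] sr.
apply: dP; first by rewrite /= in_itv/= andbT subr_ge0.
by rewrite opprB addrC subrKA distrC.
Qed.

(** The free shift [t] puts the numerical step and the exact solution under one integral over
    [[t, t + h]]. *)
Lemma pairing_h_phi1 B h t y z : 0 <= h ->
  (forall t, 0 <= t <= h -> `|sunstar_T E t| <= B) ->
  pairing E (h_phi1 E h y) z =
  \int[mu]_(s in `[t, t + h]) pairing E y (sun_T E (t + h - s) z).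
Proof.
move=> h0 BP; rewrite /h_phi1.
have eqi w s : s \in `[0, h] -> pairing E (sunstar_T E (h - s) y) w =
    pairing E y (sun_T E (h - s) w).
  by rewrite in_itv/= => /andP[_ sh]; rewrite pairing_sunstar_T// subr_ge0.
have int w : mu.-integrable `[0, h]
    (EFin \o (fun s => pairing E y (sun_T E (h - s) w))).
  exact/within_continuous_integrable/within_continuous_pairing_sun_T.
rewrite (@weak_star_integralP 0 h _ (B * `|y| * h)).
- have -> : `[t, t + h] = `[t + 0, t + h] by rewrite addr0.
  rewrite (@Rintegral_shift _ (fun s => pairing E y (sun_T E (t + h - s) z)))//.
    apply: eq_Rintegral => s; rewrite inE => /eqi ->.
    by rewrite opprD addrACA subrr add0r.
  exact: within_continuous_pairing_sun_T.
- move=> w; apply: eq_integrable (int w) => // s; rewrite inE => sh /=.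
  by rewrite eqi.
- move=> w.
  have -> : \int[mu]_(s in `[0, h]) pairing E (sunstar_T E (h - s) y) w =
      \int[mu]_(s in `[0, h]) pairing E y (sun_T E (h - s) w).
    by apply: eq_Rintegral => s; rewrite inE; exact: eqi.
  rewrite mulrAC -[in leRHS](subr0 h).
  apply: normr_Rintegral_le => // s /andP[s0 sh].
  apply: pairing_sun_T_le BP _.
  by rewrite subr_ge0 sh/= lerBlDr lerDl.
Qed.

End sun_star_frame_lemmas.

(** * Error of the exponential Euler method *)

(** The recursive estimate at [n] may assume the conclusion at all smaller indices. This is what the
    strip requires: the Lipschitz bound is available only once the earlier errors are known to be
    small. *)
Lemma discrete_gronwall (R : realType) (a b : R) (N : nat) (x : nat -> R) :
  0 <= a -> 0 <= b ->
  (forall n, (n <= N)%N -> (forall k, (k < n)%N -> x k <= a * (1 + b) ^+ k) ->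
    x n <= a + b * \sum_(k < n) x k) ->
  forall n, (n <= N)%N -> x n <= a * (1 + b) ^+ n.
Proof.
move=> a0 b0 xP; elim/ltn_ind => n IH nN.
have xk k : (k < n)%N -> x k <= a * (1 + b) ^+ k.
  by move=> kn; apply: IH => //; rewrite ltnW// (leq_trans kn).
apply: le_trans (xP n nN xk) _.
apply: (@le_trans _ _ (a + b * \sum_(k < n) a * (1 + b) ^+ k)).
  by rewrite lerD2l ler_wpM2l// ler_sum// => k _; exact: xk.
have geom : b * \sum_(k < n) (1 + b) ^+ k = (1 + b) ^+ n - 1.
  by rewrite subrX1 addrAC subrr add0r.
by rewrite -mulr_sumr mulrCA geom mulrBr mulr1 addrC subrK.
Qed.

Section error_analysis.
Context {R : realType} {X Z Y : completeNormedModType R}.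
Variable E : sun_star_frame X Z Y.
Notation mu := (@lebesgue_measure R).

(** Tested against [z], the increment of [f] is an integral whose integrand is almost everywhere at
    most the essential supremum times the norm of [z]. *)
Lemma Linfty_derivative_lipschitz (T : R) (f f' : R -> Y) :
  0 < T -> Linfty_derivative E T f f' ->
  0 <= fine (ess_sup_norm T f') /\
  forall s t, 0 <= s -> s <= t -> t <= T ->
    `|f t - f s| <= fine (ess_sup_norm T f') * (t - s).
Proof.
move=> T0 [fE fy].
(* The extended norm is nonnegative and the line has positive measure. *)
have K0 : (0 <= ess_sup_norm T f')%E.
  apply: ess_sup_gee; last first.
    by apply: aeW => s /=; rewrite lee_fin patchE; case: ifPn.
  have muT : mu [set: R] = +oo%E by rewrite -set_itvNyy lebesgue_measure_itv.
  by rewrite [ltRHS]muT.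
have := ess_sup_ge mu (EFin \o ((fun s => `|f' s|) \_ `]0, T[)).
rewrite -/(ess_sup_norm T f').
have KE : ess_sup_norm T f' = (fine (ess_sup_norm T f'))%:E.
  by rewrite fineK// ge0_fin_numE.
rewrite KE; set K := fine _ => f'K.
have {}K0 : 0 <= K by exact: fine_ge0.
split=> // s t s0 st tT; have [f'i ->] := fE s t s0 st tT.
have int z : `|\int[mu]_(r in `[s, t]) pairing E (f' r) z| <= K * (t - s) * `|z|.
  rewrite mulrAC; apply: ae_normr_Rintegral_le => //; first exact: mulr_ge0.
  apply: filterS f'K => r /= rK; rewrite in_itv/= => /andP[sr rt].
  apply: le_trans (normr_pairing_le _ _ _) _; rewrite ler_wpM2r//.
  move: rK; rewrite lee_fin patchE ifT// inE/= in_itv/=.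
  by rewrite (le_lt_trans s0 sr) (lt_le_trans rt tT).
apply: (pairing_norm_le (E := E)) => [|z]; first by rewrite mulr_ge0// subr_ge0.
by rewrite (weak_star_integralP f'i int).
Qed.

Context {T B C : R} {F : R -> X -> Y} {u0 : X} {u : R -> X}.
Hypothesis BP : forall t, 0 <= t <= T -> `|sunstar_T E t| <= B.
Hypothesis u_mild : mild_solution E T F u0 u.
Hypothesis fC : forall t, 0 <= t <= T -> `|F t (u t)| <= C.

(** The bounds [B] on the semigroup and [C] on the forcing yield the constant [B * C * t] for
    [weak_star_integralP]. *)
Lemma mild_solution_weak t z : 0 <= t <= T ->
  mu.-integrable `[0, t]
    (EFin \o (fun s => pairing E (F s (u s)) (sun_T E (t - s) z))) /\
  pairing E (sun_embed E (u t)) z =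
    pairing E (sun_embed E u0) (sun_T E t z) +
    \int[mu]_(s in `[0, t]) pairing E (F s (u s)) (sun_T E (t - s) z).
Proof.
move=> /[dup] tT /andP[t0 tT'].
have [int ->] := u_mild tT.
have eqi w s : s \in `[0, t] ->
    pairing E (sunstar_T E (t - s) (F s (u s))) w =
    pairing E (F s (u s)) (sun_T E (t - s) w).
  by rewrite in_itv/= => /andP[_ st]; rewrite pairing_sunstar_T// subr_ge0.
have int' w : mu.-integrable `[0, t]
    (EFin \o (fun s => pairing E (F s (u s)) (sun_T E (t - s) w))).
  by apply: eq_integrable (int w) => // s; rewrite inE => sh /=; rewrite eqi.
have inteq w : \int[mu]_(s in `[0, t]) pairing E (sunstar_T E (t - s) (F s (u s))) w =
    \int[mu]_(s in `[0, t]) pairing E (F s (u s)) (sun_T E (t - s) w).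
  by apply: eq_Rintegral => s; rewrite inE; exact: eqi.
split=> //; rewrite pairingD pairing_sunstar_T//; congr (_ + _).
rewrite (@weak_star_integralP _ _ _ _ _ _ _ _ (B * C * t))// => w.
rewrite inteq mulrAC -[in leRHS](subr0 t).
apply: normr_Rintegral_le => // s /andP[s0 st].
have B0 : 0 <= B := opbound_ge0 (le_trans t0 tT') BP.
have tsT : 0 <= t - s <= T.
  by rewrite subr_ge0 st (le_trans _ tT')// lerBlDr lerDl.
apply: le_trans (pairing_sun_T_le _ _ BP tsT) _.
rewrite ler_wpM2r// ler_wpM2l// fC// s0/=.
exact: le_trans tT'.
Qed.

(** Restarts the formula at time [t]: the integral over [[0, t]] is the one for [u t] tested against
    [sun_T E h z]. *)
Lemma mild_solution_step t h z : 0 <= t -> 0 <= h -> t + h <= T ->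
  pairing E (sun_embed E (u (t + h))) z =
    pairing E (sun_embed E (u t)) (sun_T E h z) +
    \int[mu]_(s in `[t, t + h])
      pairing E (F s (u s)) (sun_T E (t + h - s) z).
Proof.
move=> t0 h0 thT.
have tth : t <= t + h by rewrite lerDl.
have [|int ->] := @mild_solution_weak (t + h) z; first by rewrite addr_ge0.
have [|_ ->] := @mild_solution_weak t (sun_T E h z).
  by rewrite t0 (le_trans tth).
rewrite -addrA sun_TD//; congr (_ + _).
rewrite (Rintegral_itv_cat t0 tth int); congr (_ + _).
apply: eq_Rintegral => s; rewrite inE/= in_itv/= => /andP[s0 st].
by rewrite -sun_TD ?subr_ge0// addrAC.
Qed.

Context {N : nat} {h : R} {U : nat -> X}.
Hypothesis h0 : 0 <= h.
Hypothesis NhT : N%:R * h = T.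
Hypothesis U_euler : exponential_euler E h N F u0 U.

Definition euler_error (n : nat) : Y :=
  sun_embed E (u (n%:R * h)) - sun_embed E (U n).

Let grid_le n : (n <= N)%N -> n%:R * h <= T.
Proof. by move=> nN; rewrite -NhT ler_wpM2r// ler_nat. Qed.

Let grid_ge0 n : 0 <= n%:R * h.
Proof. by rewrite mulr_ge0. Qed.

Let gridS n : n.+1%:R * h = n%:R * h + h.
Proof. by rewrite -natr1 mulrDl mul1r. Qed.

Lemma euler_error0 : euler_error 0 = 0.
Proof.
have T0 : 0 <= T by rewrite -NhT grid_ge0.
rewrite /euler_error (proj1 U_euler) mul0r; apply: (pairing_inj (E := E)) => z.
have [|_ E0] := @mild_solution_weak 0 z; first by rewrite lexx.
by rewrite pairingB E0 set_itv1 Rintegral_set1 sun_T0 addr0 subrr /pairing linear0.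
Qed.

Lemma euler_error_step n z : (n < N)%N ->
  let t := n%:R * h in
  let d s := pairing E (F s (u s) - F t (U n)) (sun_T E (t + h - s) z) in
  mu.-integrable `[t, t + h] (EFin \o d) /\
  pairing E (euler_error n.+1) z =
    pairing E (euler_error n) (sun_T E h z) + \int[mu]_(s in `[t, t + h]) d s.
Proof.
move=> nN t d.
have t0 : 0 <= t := grid_ge0 n.
have thT : t + h <= T by rewrite -gridS grid_le.
have hT : h <= T by rewrite (le_trans _ thT)// lerDr.
have int1 : mu.-integrable `[t, t + h]
    (EFin \o (fun s => pairing E (F s (u s)) (sun_T E (t + h - s) z))).
  have [|int _] := @mild_solution_weak (t + h) z; first by rewrite addr_ge0.
  exact: integrable_itvS int.
have int2 : mu.-integrable `[t, t + h]
    (EFin \o (fun s => pairing E (F t (U n)) (sun_T E (t + h - s) z))).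
  exact/within_continuous_integrable/within_continuous_pairing_sun_T.
have dE s : d s = pairing E (F s (u s)) (sun_T E (t + h - s) z) -
    pairing E (F t (U n)) (sun_T E (t + h - s) z) by exact: pairingB.
split.
  have : mu.-integrable `[t, t + h] (EFin \o (fun s =>
      pairing E (F s (u s)) (sun_T E (t + h - s) z) -
      pairing E (F t (U n)) (sun_T E (t + h - s) z))).
    by have := integrableB _ int1 int2; apply.
  by congr (mu.-integrable _ _); apply/funext => s /=; rewrite dE.
have -> : \int[mu]_(s in `[t, t + h]) d s =
  \int[mu]_(s in `[t, t + h]) pairing E (F s (u s)) (sun_T E (t + h - s) z) -
  \int[mu]_(s in `[t, t + h]) pairing E (F t (U n)) (sun_T E (t + h - s) z).
  by rewrite -RintegralB//; apply: eq_Rintegral => s _.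
rewrite /euler_error gridS !pairingB mild_solution_step//.
rewrite (proj2 U_euler n nN) pairingD pairing_sunstar_T//.
rewrite (@pairing_h_phi1 _ _ _ _ E B h t)//; first by ring.
move=> r /andP[r0 rh]; apply: BP.
by rewrite r0 (le_trans rh).
Qed.

(* The extra factor sun_T r makes the recursion telescope with the single
   constant B; iterating a one-step bound on the norms would produce B ^+ n. *)
Lemma pairing_euler_error_le (g : nat -> R) n :
  (n <= N)%N ->
  (forall k s, (k < n)%N -> k%:R * h <= s <= k%:R * h + h ->
    `|F s (u s) - F (k%:R * h) (U k)| <= g k) ->
  forall r z, 0 <= r -> n%:R * h + r <= T ->
  `|pairing E (euler_error n) (sun_T E r z)| <=
    h * B * (\sum_(k < n) g k) * `|z|.
Proof.
elim: n => [|n IH] nN gP r z r0 rT.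
  by rewrite big_ord0 mulr0 mul0r euler_error0 /pairing linear0 normr0.
have [int ->] := euler_error_step (sun_T E r z) nN.
rewrite big_ord_recr/= mulrDr mulrDl.
apply: le_trans (ler_normD _ _) _; apply: lerD.
  (* The induction hypothesis is used with [h + r] in place of [r]. *)
  rewrite -sun_TD//; apply: IH; rewrite ?addr_ge0//; first exact: ltnW.
    by move=> k s kn; apply: gP; rewrite ltnS ltnW.
  by rewrite addrA -gridS.
set t := n%:R * h in int *.
have T0 : 0 <= T by rewrite -NhT grid_ge0.
have B0 : 0 <= B := opbound_ge0 T0 BP.
have -> : h * B * g n * `|z| = (B * g n * `|z|) * (t + h - t) by ring.
apply: normr_Rintegral_le => //; first by rewrite lerDl.
move=> s /andP[ts st]; rewrite -sun_TD ?subr_ge0//.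
have tsT : 0 <= t + h - s + r <= T.
  rewrite addr_ge0 ?subr_ge0//=.
  apply: le_trans rT; rewrite gridS lerD2r// lerBlDr lerDl.
  by rewrite (le_trans _ ts)// grid_ge0.
apply: le_trans (pairing_sun_T_le _ _ BP tsT) _.
by rewrite ler_wpM2r// ler_wpM2l// gP// ts.
Qed.

Lemma euler_error_le (g : nat -> R) n : (n <= N)%N ->
  (forall k s, (k < n)%N -> k%:R * h <= s <= k%:R * h + h ->
    `|F s (u s) - F (k%:R * h) (U k)| <= g k) ->
  `|euler_error n| <= h * B * \sum_(k < n) g k.
Proof.
move=> nN gP.
have T0 : 0 <= T by rewrite -NhT grid_ge0.
apply: (pairing_norm_le (E := E)) => [|z].
  rewrite !mulr_ge0 ?(opbound_ge0 T0 BP)// sumr_ge0// => k _.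
  by apply: le_trans (normr_ge0 _) (gP k (k%:R * h) _ _); rewrite ?lexx ?lerDl.
rewrite -{1}(sun_T0 E z); apply: pairing_euler_error_le => //.
by rewrite addr0 grid_le.
Qed.

Context {K L r : R}.
Hypothesis K0 : 0 <= K.
Hypothesis f_lip : forall s t, 0 <= s -> s <= t -> t <= T ->
  `|F t (u t) - F s (u s)| <= K * (t - s).
Hypothesis L0 : 0 <= L.
Hypothesis r0 : 0 <= r.
Hypothesis F_lip : forall t, 0 <= t <= T -> forall w v : X,
  `|sun_embed E w - sun_embed E (u t)| <= r ->
  `|sun_embed E v - sun_embed E (u t)| <= r ->
  `|F t w - F t v| <= L * `|sun_embed E w - sun_embed E v|.
Hypothesis small : T * B * expR (T * B * L) * K * h <= r.

(** Gronwall with [a = T * B * K * h] and [b = h * B * L]. *)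
Lemma euler_error_in_strip n : (n <= N)%N ->
  `|euler_error n| <= T * B * expR (T * B * L) * K * h.
Proof.
have T0 : 0 <= T by rewrite -NhT grid_ge0.
have B0 : 0 <= B := opbound_ge0 T0 BP.
(* [(1 + h * B * L) ^+ k] is at most the exponential of [k * h * B * L], and [k * h <= T] makes this
   independent of the grid. *)
have pow_le k : (k <= N)%N ->
    T * B * K * h * (1 + h * B * L) ^+ k <= T * B * expR (T * B * L) * K * h.
  move=> kN; have -> : T * B * expR (T * B * L) * K * h =
    T * B * K * h * expR (T * B * L) by ring.
  apply: ler_wpM2l; first by rewrite !mulr_ge0.
  apply: (@le_trans _ _ (expR (h * B * L) ^+ k)).
    by rewrite lerXn2r ?nnegrE ?addr_ge0 ?mulr_ge0 ?expR_ge0 ?expR_ge1Dx.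
  rewrite -expRM_natl ler_expR !mulrA ler_wpM2r// ler_wpM2r//.
  exact: grid_le.
move=> nN; apply: le_trans (pow_le n nN); move: n nN.
apply: discrete_gronwall => [||n nN IH]; rewrite ?mulr_ge0//.
(* Inserting the forcing at the exact value [u (k * h)] separates the variation of [f] over one step
   from the Lipschitz effect of the error, which lies in the strip by [IH] and [small]. *)
have gP k s : (k < n)%N -> k%:R * h <= s <= k%:R * h + h ->
    `|F s (u s) - F (k%:R * h) (U k)| <= K * h + L * `|euler_error k|.
  move=> kn /andP[ks sk].
  have kN : (k < N)%N := leq_trans kn nN.
  rewrite -(subrKA (F (k%:R * h) (u (k%:R * h)))).
  apply: le_trans (ler_normD _ _) _; apply: lerD.
    apply: le_trans (f_lip (grid_ge0 k) ks _) _.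
      by rewrite (le_trans sk)// -gridS grid_le.
    by rewrite ler_wpM2l// lerBlDl.
  apply: F_lip; first by rewrite grid_ge0 grid_le// ltnW.
    by rewrite subrr normr0.
  rewrite distrC (le_trans (IH k kn))//.
  by apply: le_trans (pow_le k (ltnW kN)) _.
apply: le_trans (euler_error_le nN gP) _.
rewrite big_split/= mulrDr; apply: lerD; last by rewrite -mulr_sumr mulrA.
rewrite sumr_const card_ord -mulr_natl.
have -> : h * B * (n%:R * (K * h)) = n%:R * h * (B * K * h) by ring.
have -> : T * B * K * h = T * (B * K * h) by ring.
by rewrite ler_wpM2r ?mulr_ge0// grid_le.
Qed.

End error_analysis.

(** The scheme prescribes only the image in [Y] of each iterate; injectivity of the embedding
    determines the iterate in [X]. *)
Lemma exponential_euler_unique (R : realType) (X Z Y : completeNormedModType R)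
    (E : sun_star_frame X Z Y) (h : R) (N : nat) (F : R -> X -> Y) (u0 : X)
    (U U' : nat -> X) :
  exponential_euler E h N F u0 U -> exponential_euler E h N F u0 U' ->
  forall n, (n <= N)%N -> U n = U' n.
Proof.
move=> [U0 US] [U'0 U'S]; elim=> [|n IH] nN; first by rewrite U0 U'0.
by apply: (@sun_embed_inj _ _ _ _ E); rewrite US// U'S// IH// ltnW.
Qed.

Unset Implicit Arguments.
Set Strict Implicit.

Theorem theorem4p6 (R : realType) (X Z Y : completeNormedModType R)
  (E : sun_star_frame X Z Y)
  (M omega : R)
  (growth : forall t, 0 <= t -> `|sunstar_T E t| <= M * expR (omega * t))
  (T : R) (T_gt0 : 0 < T)
  (DA0 : set X) (A0 : X -> Y) (A0_generator : is_generator E DA0 A0)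
  (F : R -> X -> Y) (u0 : X) (u : R -> X)
  (u_mild : mild_solution E T F u0 u)
  (F_lipschitz : lipschitz_in_strip E T F u)
  (f' : R -> Y)
  (f'_Linfty : Linfty_derivative E T (fun t => F t (u t)) f') :
  exists C : R, forall (N : nat) (U : nat -> X), (0 < N)%N ->
    let h := T / N%:R in
    exponential_euler E h N F u0 U ->
    forall n, (1 <= n <= N)%N ->
      `|u (n%:R * h) - U n| <= C * fine (ess_sup_norm T f') * h.
Proof.
have [B B0 BP] := sunstar_T_bounded (T := T) growth.
have [K0 f_lip] := Linfty_derivative_lipschitz T_gt0 f'_Linfty.
set K := fine (ess_sup_norm T f') in K0 f_lip *.
have [r r0 rP] := F_lipschitz.
have [|L L0 F_lip] := rP r; first by rewrite lexx ltW.
have [k k0 kP] := norm_le_sun_embed E.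
have f_bounded t : 0 <= t <= T -> `|F t (u t)| <= `|F 0 (u 0)| + K * T.
  move=> /andP[t0 tT]; rewrite -[F t (u t)](subrK (F 0 (u 0))) addrC.
  apply: le_trans (ler_normD _ _) _; rewrite lerD2l.
  apply: le_trans (f_lip 0 t _ t0 tT) _ => //.
  by rewrite subr0 ler_wpM2l.
pose C1 := T * B * expR (T * B * L).
have C10 : 0 <= C1 by rewrite !mulr_ge0 ?expR_ge0// ltW.
pose err_le c N := forall U : nat -> X, let h := T / N%:R in
  exponential_euler E h N F u0 U ->
  forall n, (n <= N)%N -> `|u (n%:R * h) - U n| <= c * K * h.
have h0 (N : nat) : 0 <= T / N%:R by rewrite divr_ge0// ltW.
have fine_grid N : (0 < N)%N -> C1 * K * (T / N%:R) <= r -> err_le (k * C1) N.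
  move=> N0 small U h U_euler n nN.
  apply: le_trans (kP _) _; rewrite sun_embedB.
  have -> : k * C1 * K * h = k * (C1 * K * h) by rewrite !mulrA.
  apply: ler_wpM2l => //.
  have NhT : N%:R * h = T by rewrite mulrC divfK// pnatr_eq0 -lt0n.
  exact: (euler_error_in_strip BP u_mild f_bounded (h0 N) NhT U_euler
            K0 f_lip (ltW L0) (ltW r0) F_lip small nN).
have each_grid N : exists c, (0 < N)%N -> err_le c N.
  have [N0|] := ltnP 0 N; last by exists 0.
  have [small|large] := leP (C1 * K * (T / N%:R)) r.
    by exists (k * C1) => _; exact: fine_grid.
  have hN : 0 < T / N%:R by rewrite divr_gt0// ltr0n.
  (* With [K = 0] the left side of [large] would vanish, so a coarse grid allows division by [K]. *)
  have K_gt0 : 0 < K.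
    rewrite lt_neqAle K0 andbT; apply: contraTneq large => <-.
    by rewrite mulr0 mul0r -leNgt ltW.
  (* Existence of approximations is decided classically; without any, the bound is vacuous.
     Otherwise uniqueness lets the constant be read off from the single family [V]. *)
  have [[V V_euler]|noV] :=
      pselect (exists V, exponential_euler E (T / N%:R) N F u0 V); last first.
    by exists 0 => _ U h U_euler; exfalso; apply: noV; exists U.
  pose e i := `|u (i%:R * (T / N%:R)) - V i|.
  exists ((\sum_(i < N.+1) e i) / (K * (T / N%:R))) => _ U h U_euler n nN.
  have Kh0 : K * (T / N%:R) != 0 by apply: mulf_neq0; rewrite gt_eqF.
  rewrite -mulrA divfK//.
  rewrite (exponential_euler_unique U_euler V_euler nN) -/(e n).
  rewrite -ltnS in nN.
  by rewrite (bigD1 (Ordinal nN))//= lerDl; apply: sumr_ge0 => i _; exact: normr_ge0.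
have [c cP] := choice each_grid.
(* From [N0] on, [C1 * K * (T / N) <= r], so only finitely many grids are coarse. *)
pose N0 := (Num.truncn (C1 * K * T / r)).+1.
(* One constant for all grids: [k * C1] serves [N >= N0], and the sum dominates [c N] for every
   [N < N0]. *)
exists (k * C1 + \sum_(i < N0) `|c i|) => N U Npos h U_euler n /andP[_ nN].
have sum0 : 0 <= \sum_(i < N0) `|c i| by exact: sumr_ge0.
have weaken a b : a <= b -> a * K * h <= b * K * h.
  by move=> ab; apply: ler_wpM2r; [exact: h0|exact: ler_wpM2r].
have [NN0|N0N] := ltnP N N0.
  apply: le_trans (cP N Npos U U_euler n nN) (weaken _ _ _).
  apply: le_trans (ler_norm _) _.
  rewrite (bigD1 (Ordinal NN0))//= addrCA lerDl.
  by apply: addr_ge0; [exact: mulr_ge0|exact: sumr_ge0].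
apply: le_trans (fine_grid N Npos _ U U_euler n nN) (weaken _ _ _).
  rewrite mulrA ler_pdivrMr ?ltr0n// [leRHS]mulrC -ler_pdivrMr//.
  by apply/ltW/(lt_le_trans (truncnS_gt _)); rewrite ler_nat.
by rewrite lerDl.
Qed.
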